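(* Let $w\in Y$ be such that $\xi:=K^*w\in\partial R(x^\dagger)$. Assume that for every $\alpha>0$ and every datum $y\in Y$ the functional $x\mapsto\tfrac12\|Kx-y\|^2+\alpha R(x)$ is coercive and has a unique minimizer. Let $(y^\delta)_{\delta>0}\subset Y$ be a family with $0<\|y^\dagger-y^\delta\|\le\delta$, and assume there exists $\epsilon>0$ such that for every $\delta>0$ $$\|Q(y^\dagger-y^\delta)\|\ge\epsilon\|y^\dagger-y^\delta\|,$$ where $Q$ is the orthogonal projection of $Y$ onto the orthogonal complement of the closure of the range of $K$. For each $\delta>0$ let $\phi(\alpha)=\|Kx_\alpha^\delta-y^\delta\|^2/\alpha$, and let $\alpha^*(y^\delta)\in(0,\|K\|^2]$ satisfy $\phi(\alpha^*(y^\delta))\le\phi(\alpha)$ for all $\alpha\in(0,\|K\|^2]$. Then $$D_{\xi}\bigl(x_{\alpha^*(y^\delta)}^\delta,x^\dagger\bigr)\to0\quad\text{as }\delta\to0 .$$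
   Context: $X$ is a real Banach space, $Y$ a real Hilbert space, $K:X\to Y$ a bounded linear operator with adjoint $K^*:Y\to X^*$ ($Y$ identified with its dual). $R:X\to[0,\infty]$ is proper, convex, weakly lower semicontinuous and coercive. The exact data $y^\dagger$ lie in the range of $K$. For $\alpha>0$, $x_\alpha^\delta$ denotes the minimizer over $x\in X$ of $\tfrac12\|Kx-y^\delta\|^2+\alpha R(x)$. $x^\dagger$ is an $R$-minimum solution: $Kx^\dagger=y^\dagger$ and $R(x^\dagger)=\min\{R(x): Kx=y^\dagger\}<\infty$. $\partial R(x)\subset X^*$ is the subdifferential. For $\xi\in\partial R(x)$ the Bregman distance is $D_\xi(x',x)=R(x')-R(x)-\langle\xi,x'-x\rangle$. *)

(* Defs.v *)
From HB Require Import structures.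
From mathcomp Require Import all_boot all_order all_algebra.
From mathcomp Require Import all_classical all_reals all_analysis.
Import Order.TTheory GRing.Theory Num.Theory.
Import numFieldNormedType.Exports.

Set Implicit Arguments.
Unset Strict Implicit.
Unset Printing Implicit Defensive.

Local Open Scope classical_set_scope.
Local Open Scope ring_scope.

(* A real Hilbert space is a [completeNormedModType R] together with a positive
   definite symmetric form [dot : {dot Y for idfun}] that induces its norm. *)

Definition dual_space (R : realType) (X : normedModType R) : set (X -> R) :=
  [set f : X -> R | scalar f /\ continuous f].

(* The coarsest topology on X that makes every element of the dual space
   continuous. *)
Definition weak_topology (R : realType) (X : normedModType R)
    : topologicalType :=
  sup_topology (fun f : {f : X -> R | dual_space f} =>
    Topological.on (initial_topology (sval f))).

Definition weakly_lower_semicontinuous (R : realType) (X : normedModType R)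
    (f : X -> \bar R) : Prop :=
  lower_semicontinuous (f : weak_topology X -> \bar R).

Definition proper_functional (R : realType) (X : Type) (f : X -> \bar R) : Prop :=
  (forall x, -oo < f x)%E /\ exists x, (f x < +oo)%E.

(* [convex_function] only covers functions with finite values.  For t = 0 or
   t = 1 the convention 0 * +oo = 0 makes the inequality trivial. *)
Definition econvex (R : realType) (X : lmodType R) (f : X -> \bar R) : Prop :=
  forall (x y : X) (t : R), 0 <= t <= 1 ->
    (f (t *: x + (1 - t) *: y)%R <= t%:E * f x + (1 - t)%R%:E * f y)%E.

Definition coercive (R : realType) (X : normedModType R) (f : X -> \bar R)
    : Prop :=
  forall M : R, exists r : R, forall x, r <= `|x| -> (M%:E <= f x)%E.

Definition minimizer (R : realType) (X : Type) (f : X -> \bar R) (x : X)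
    : Prop :=
  forall z, (f x <= f z)%E.

Definition opnorm (R : realType) (X Y : normedModType R) (K : X -> Y) : R :=
  sup [set `|K x| | x in [set x : X | `|x| <= 1]].

(* With Y identified with its dual through the inner product, K^* w is the
   functional w o K. *)
Definition adjoint (R : realType) (X Y : normedModType R)
    (dot : Y -> Y -> R) (K : X -> Y) (w : Y) : X -> R :=
  fun x => dot w (K x).

Definition orthogonal_complement (R : realType) (Y : normedModType R)
    (dot : Y -> Y -> R) (A : set Y) : set Y :=
  [set y | forall z, A z -> dot y z = 0].

Definition orthogonal_projection (R : realType) (Y : normedModType R)
    (dot : Y -> Y -> R) (M : set Y) (P : Y -> Y) : Prop :=
  forall y, M (P y) /\ orthogonal_complement dot M (y - P y).

Definition subdifferential (R : realType) (X : normedModType R)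
    (f : X -> \bar R) (x : X) : set (X -> R) :=
  [set xi | dual_space xi /\ forall z, (f x + (xi (z - x)%R)%:E <= f z)%E].

Definition bregman (R : realType) (X : normedModType R)
    (f : X -> \bar R) (xi : X -> R) (x' x : X) : \bar R :=
  (f x' - f x - (xi (x' - x)%R)%:E)%E.

Definition tikhonov (R : realType) (X Y : normedModType R)
    (K : X -> Y) (Reg : X -> \bar R) (alpha : R) (y : Y) (x : X) : \bar R :=
  ((2^-1 * `|K x - y| ^+ 2)%R%:E + alpha%:E * Reg x)%E.

Definition reg_minimum_solution (R : realType) (X Y : normedModType R)
    (K : X -> Y) (Reg : X -> \bar R) (y : Y) (x : X) : Prop :=
  [/\ K x = y, forall z, K z = y -> (Reg x <= Reg z)%E & (Reg x < +oo)%E].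

(* [x alpha] plays the role of the Tikhonov minimizer for the datum [y]. *)
Definition heuristic_phi (R : realType) (X Y : normedModType R)
    (K : X -> Y) (y : Y) (x : R -> X) (alpha : R) : R :=
  `|K (x alpha) - y| ^+ 2 / alpha.

(* Main.v *)
Require Import Defs.
From HB Require Import structures.
From mathcomp Require Import all_boot all_order all_algebra.
From mathcomp Require Import all_classical all_reals all_analysis.
From mathcomp Require Import ring lra.
Import Order.TTheory GRing.Theory Num.Theory.
Import numFieldNormedType.Exports.

Local Open Scope classical_set_scope.
Local Open Scope ring_scope.

(* Write p = |K x - y^delta| and t = |ydag - y^delta|.  Comparing the Tikhonov
   functional at its minimizer and at xdag gives, by the source condition,
   p^2/2 + alpha D <= t^2/2 + alpha |w| (p + t), where D >= 0 is the Bregman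
   distance.  Hence p <= t + 2 alpha |w|, so the choice alpha = t yields
   phi(alpha^* ) <= (1 + 2 |w|)^2 t.  The residual cannot be smaller than the
   component Q (ydag - y^delta), so p >= eps t and
   t^2 / alpha^* <= phi(alpha^* ) / eps^2 is O(t).  Also
   p^2 <= |K|^2 phi(alpha^* ) is O(t), and the first estimate shows that
   D <= t^2 / (2 alpha^* ) + |w| (p + t) tends to 0. *)

Section RealInnerProduct.
Context {R : realType} {Y : normedModType R} (dot : {dot Y for (idfun : R -> R)}).
Hypothesis dot_norm : forall y : Y, `|y| = Num.sqrt (dot y y).

Lemma dotC u v : dot u v = dot v u.
Proof. by rewrite (hermC dot) expr0 mul1r. Qed.

Lemma dot_sqr u : dot u u = `|u| ^+ 2.
Proof.
rewrite dot_norm sqr_sqrtr//.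
have [->|u0] := eqVneq u 0; first by rewrite linear0l.
by rewrite ltW// neq0_dnorm_gt0.
Qed.

(** Cauchy-Schwarz comes from the triangle inequality, already available for the norm of [Y]:
    squaring it and expanding both sides leaves the cross terms. *)
Lemma dot_le_norm u v : dot u v <= `|u| * `|v|.
Proof.
have : `|u + v| ^+ 2 <= (`|u| + `|v|) ^+ 2.
  by rewrite lerXn2r ?nnegrE ?addr_ge0 ?ler_normD.
rewrite -dot_sqr linearDl !linearDr /= !dot_sqr (dotC v u) sqrrD.
lra.
Qed.

(* [Q e] is orthogonal to [A], hence [|Q e|^2 = dot (e - a) (Q e)]. *)
Lemma norm_proj_complement_le (A : set Y) (Q : Y -> Y) (a e : Y) :
  orthogonal_projection dot (orthogonal_complement dot (closure A)) Q ->
  A a -> `|Q e| <= `|e - a|.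
Proof.
move=> /(_ e)[QeA eQe] Aa.
have aQ : dot a (Q e) = 0 by rewrite dotC QeA//; exact: subset_closure.
have : `|Q e| ^+ 2 <= `|e - a| * `|Q e|.
  apply: le_trans (dot_le_norm _ _).
  by rewrite -dot_sqr -subr_ge0 -linearBl/= addrAC linearBl/= eQe// aQ subr0.
have [->|Q0] := eqVneq (Q e) 0; first by rewrite normr0.
by rewrite expr2 ler_pM2r// normr_gt0.
Qed.

End RealInnerProduct.

Section TikhonovMinimizer.
Context {R : realType} {X Y : normedModType R}.
Context (dot : {dot Y for (idfun : R -> R)}).
Hypothesis dot_norm : forall y : Y, `|y| = Num.sqrt (dot y y).
Context (K : {linear X -> Y}) (Reg : X -> \bar R).
Hypothesis Reg_ge0 : forall x, (0 <= Reg x)%E.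
Context (xdag : X) (w : Y).
Hypothesis Reg_xdag : (Reg xdag < +oo)%E.
Hypothesis source : subdifferential Reg xdag (adjoint dot K w).
Context (alpha : R) (y : Y) (x : X).
Hypothesis alpha_gt0 : 0 < alpha.
Hypothesis x_min : minimizer (tikhonov K Reg alpha y) x.

Let p := `|K x - y|.
Let t := `|K xdag - y|.

(** The real witness [d] records that the extended-real Bregman distance is finite here. The linear
    term is controlled by Cauchy-Schwarz and the triangle inequality through [y], since
    [K x - K xdag] has norm at most [p + t]. *)
Lemma bregman_tikhonov : exists d : R,
  [/\ bregman Reg (adjoint dot K w) x xdag = d%:E, 0 <= d &
      2^-1 * p ^+ 2 + alpha * d <=
      2^-1 * t ^+ 2 + alpha * (`|w| * (p + t))].
Proof.
have fin_dag : Reg xdag \is a fin_num by rewrite ge0_fin_numE.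
have := x_min xdag; have := source.2 x; have := Reg_ge0 x.
rewrite /bregman /tikhonov /adjoint -/p -/t -(fineK fin_dag).
set s := dot w _; set r0 := fine _.
(* The value [+oo] would make the Tikhonov functional infinite at its minimizer, although it is
   finite at [xdag]. *)
case: (Reg x) => [r| |]//=; last by rewrite gt0_muley// -EFinM -EFinD.
rewrite -!EFinM -!EFinD !lee_fin => r_ge0 sr xmin.
have s_ge : - s <= `|w| * (p + t).
  rewrite /s -linearNr; apply: le_trans (dot_le_norm dot dot_norm _ _) _.
  by rewrite ler_wpM2l// normrN linearB /p /t [`|K xdag - y|]distrC ler_distD.
exists (r - r0 - s); split => //; first lra.
have : alpha * - s <= alpha * (`|w| * (p + t)) by rewrite ler_pM2l.
nra.
Qed.

(** Drop [alpha * d], which is nonnegative, and complete the square in [p] and in [t] by adding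
    [(alpha * |w|) ^+ 2] to both sides. *)
Lemma tikhonov_residual_le : p <= t + 2 * alpha * `|w|.
Proof.
have [d [_ d_ge0 dle]] := bregman_tikhonov.
have : `|p - alpha * `|w| | ^+ 2 <= (t + alpha * `|w|) ^+ 2.
  by have := mulr_ge0 (ltW alpha_gt0) d_ge0; rewrite real_normK ?num_real//; lra.
have tw : 0 <= t + alpha * `|w| by rewrite /t addr_ge0// mulr_ge0// ltW.
rewrite ler_sqr ?nnegrE// => /ler_normlW.
lra.
Qed.

End TikhonovMinimizer.

Theorem theorem3p5
    (R : realType) (X Y : completeNormedModType R)
    (dot : {dot Y for (idfun : R -> R)})
    (dot_norm : forall y : Y, `|y| = Num.sqrt (dot y y))
    (K : {linear X -> Y}) (K_bounded : bounded_fun_norm K)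
    (Reg : X -> \bar R)
    (Reg_ge0 : forall x, (0 <= Reg x)%E)
    (Reg_proper : proper_functional Reg)
    (Reg_convex : econvex Reg)
    (Reg_wlsc : weakly_lower_semicontinuous Reg)
    (Reg_coercive : coercive Reg)
    (ydag : Y) (ydag_range : range K ydag)
    (xdag : X) (xdag_min : reg_minimum_solution K Reg ydag xdag)
    (w : Y) (source : subdifferential Reg xdag (adjoint dot K w))
    (tikhonov_wellposed : forall (alpha : R) (y : Y), 0 < alpha ->
      coercive (tikhonov K Reg alpha y) /\
      exists! x : X, minimizer (tikhonov K Reg alpha y) x)
    (y : R -> Y)
    (noise : forall delta : R, 0 < delta -> 0 < `|ydag - y delta| <= delta)
    (Q : Y -> Y)
    (Q_proj : orthogonal_projection dot
      (orthogonal_complement dot (closure (range K))) Q)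
    (eps : R) (eps_gt0 : 0 < eps)
    (noise_Q : forall delta : R, 0 < delta ->
      eps * `|ydag - y delta| <= `|Q (ydag - y delta)|)
    (x : R -> R -> X)
    (x_min : forall delta alpha : R, 0 < delta -> 0 < alpha ->
      minimizer (tikhonov K Reg alpha (y delta)) (x delta alpha))
    (alpha_star : R -> R)
    (alpha_star_in : forall delta : R, 0 < delta ->
      0 < alpha_star delta <= opnorm K ^+ 2)
    (alpha_star_min : forall delta alpha : R, 0 < delta ->
      0 < alpha <= opnorm K ^+ 2 ->
      heuristic_phi K (y delta) (x delta) (alpha_star delta) <=
      heuristic_phi K (y delta) (x delta) alpha) :
  bregman Reg (adjoint dot K w) (x delta (alpha_star delta)) xdag
    @[delta --> 0^'+] --> 0%E.
Proof.
have [Kxdag _ Reg_xdag] := xdag_min.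
set L := opnorm K ^+ 2 in alpha_star_in alpha_star_min *.
(* The interval for [alpha_star 1] is nonempty, which excludes a zero operator. *)
have L_gt0 : 0 < L.
  by have /andP[/lt_le_trans] := alpha_star_in 1 ltr01; apply.
pose C := (1 + 2 * `|w|) ^+ 2.
have C_ge0 : 0 <= C by exact: sqr_ge0.
(* The first term will bound [t ^+ 2 / a], the square root [p], and the last [delta] the noise
   [t]. *)
pose h (delta : R) :=
  C / eps ^+ 2 * delta + `|w| * (Num.sqrt (L * C * delta) + delta).
apply: (@squeeze_cvge _ _ _ _ (cst 0%E) _ (EFin \o h)).
- near=> delta.
  have delta_gt0 : 0 < delta by near: delta; exact: nbhs_right_gt.
  (* This makes [t] an admissible competitor of [alpha_star delta]. *)
  have delta_le : delta <= L by near: delta; exact: nbhs_right_le.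
  have /andP[t_gt0 t_le] := noise delta delta_gt0.
  have /andP[a_gt0 a_le] := alpha_star_in delta delta_gt0.
  have := noise_Q delta delta_gt0.
  set t := `|ydag - y delta| in t_gt0 t_le *; set a := alpha_star delta in a_gt0 a_le *.
  move=> epst.
  have [d [-> d_ge0]] := bregman_tikhonov dot dot_norm K Reg Reg_ge0 xdag w
    Reg_xdag source a (y delta) (x delta a) a_gt0 (x_min delta a delta_gt0 a_gt0).
  rewrite Kxdag -/t; set p := `|K (x delta a) - y delta| => d_le.
  have p_ge0 : 0 <= p by exact: normr_ge0.
  have p_ge : eps * t <= p.
    apply: le_trans epst _.
    (* The residual is the distance from the noise to an element of the range of [K]. *)
    have -> : p = `|(ydag - y delta) - K (xdag - x delta a)|.
      by rewrite linearB /= Kxdag opprB addrC subrKA.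
    by apply: norm_proj_complement_le Q_proj _ => //; exists (xdag - x delta a).
  have tP : t <= L by exact: le_trans delta_le.
  have phi_le : p ^+ 2 / a <= C * t.
    apply: le_trans (alpha_star_min delta t delta_gt0 _) _; first by rewrite t_gt0 tP.
    rewrite /heuristic_phi ler_pdivrMr//.
    have := tikhonov_residual_le dot dot_norm K Reg Reg_ge0 xdag w
      Reg_xdag source t (y delta) (x delta t) t_gt0 (x_min delta t delta_gt0 t_gt0).
    rewrite Kxdag -/t => pt.
    rewrite -mulrA -expr2 -exprMn ler_sqr ?nnegrE//; first lra.
    by rewrite mulr_ge0 ?(ltW t_gt0)// addr_ge0// mulr_ge0.
  have p2_le : p ^+ 2 <= C * t * a by rewrite -ler_pdivrMr.
  have Ct_le : C * t <= C * delta by rewrite ler_wpM2l.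
  have p_le : p <= Num.sqrt (L * C * delta).
    rewrite -(ger0_norm p_ge0) -sqrtr_sqr ler_wsqrtr//.
    apply: le_trans p2_le _; rewrite mulrC -mulrA.
    by rewrite ler_pM ?mulr_ge0// ltW.
  (* Here [eps] enters: [(eps * t) ^+ 2 <= p ^+ 2 <= C * delta * a] keeps [a] from being too small
     compared with [t ^+ 2]. *)
  have t2_le : t ^+ 2 <= C / eps ^+ 2 * delta * a.
    have -> : C / eps ^+ 2 * delta * a = C * delta * a / eps ^+ 2 by ring.
    rewrite ler_pdivlMr ?exprn_gt0// mulrC -exprMn.
    apply: le_trans (_ : p ^+ 2 <= _).
      by rewrite ler_sqr ?nnegrE// mulr_ge0// ltW.
    by apply: le_trans p2_le _; rewrite ler_pM2r.
  rewrite /= !lee_fin d_ge0 -(ler_pM2l a_gt0) /h mulrDr /=.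
  apply: le_trans (_ : t ^+ 2 + a * (`|w| * (p + t)) <= _).
    have := sqr_ge0 t; have := sqr_ge0 p; lra.
  by rewrite [a * (_ * delta)]mulrC lerD// ler_pM2l// ler_wpM2l// lerD.
- exact: cvg_cst.
- apply: cvg_EFin; first by near=> delta.
  (* The two-sided limit is no harder: [Num.sqrt] vanishes on negative reals, so [h] is continuous
     at 0 from both sides. *)
  apply: cvg_at_right_filter.
  have h0 : h 0 = 0 by rewrite /h !(mulr0, sqrtr0, addr0).
  suff : h z @[z --> (0 : R)] --> h 0 by rewrite h0.
  have Mid (c : R) : c * z @[z --> (0 : R)] --> c * 0.
    by apply: cvgM; [exact: cvg_cst|exact: cvg_id].
  apply: cvgD; first exact: Mid.
  apply: cvgM; first exact: cvg_cst.
  apply: cvgD; last exact: cvg_id.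
  by apply: continuous_comp; [exact: Mid|exact: sqrt_continuous].
Unshelve. all: by end_near.
Qed.
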